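(* Let $\mathcal{C}$ be a minimal (nondegenerate) $[\mathbf{n},k]_{q^m/q}$ sum-rank metric code, with $\mathbf{n}=(n_1,\ldots,n_t)$. If $t\geq k$, then \[ (q^{n_1}+\cdots+q^{n_t}-t)(q^{m(k-1)}-1)\geq (q-1)(k-1)(q^{km}-1). \] If $t\leq k-1$, then \[ (q^{n_1}+\cdots+q^{n_t}-t)(q^{m(k-1)}-1)\geq t\left(q^{\left\lfloor \frac{k-1}{t}\right\rfloor}-1\right)(q^{km}-1). \]
   Context: Let $q$ be a prime power, $m,t,k$ positive integers, $\mathbf{n}=(n_1,\ldots,n_t)$ a tuple of positive integers with $n_1\ge\cdots\ge n_t$, and $\mathbb{F}_{q^m}^{\mathbf{n}}=\bigoplus_{i=1}^t\mathbb{F}_{q^m}^{n_i}$. The rank of $v=(v_1,\ldots,v_n)\in\mathbb{F}_{q^m}^n$ is $\mathrm{rk}(v)=\dim_{\mathbb{F}_q}\langle v_1,\ldots,v_n\rangle_{\mathbb{F}_q}$; the sum-rank weight of $x=(x_1,\ldots,x_t)\in\mathbb{F}_{q^m}^{\mathbf{n}}$ is $w(x)=\sum_{i=1}^t\mathrm{rk}(x_i)$, and the sum-rank distance is $d(x,y)=w(x-y)$. An $[\mathbf{n},k]_{q^m/q}$ (sum-rank metric) code is a $k$-dimensional $\mathbb{F}_{q^m}$-subspace $\mathcal{C}$ of $\mathbb{F}_{q^m}^{\mathbf{n}}$ with this distance. A generator matrix is $G=(G_1|\cdots|G_t)$, $G_i\in\mathbb{F}_{q^m}^{k\times n_i}$,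 whose rows form a basis of $\mathcal{C}$. $\mathcal{C}$ is nondegenerate if for each $i$ the columns of $G_i$ are $\mathbb{F}_q$-linearly independent. All codes are assumed nondegenerate. Support: fix an $\mathbb{F}_q$-basis of $\mathbb{F}_{q^m}$; for $x_i\in\mathbb{F}_{q^m}^{n_i}$ let $\Gamma(x_i)\in\mathbb{F}_q^{n_i\times m}$ be the matrix whose $j$-th row consists of the coordinates of the $j$-th entry of $x_i$. The sum-rank support of $x$ is the tuple $(\mathrm{colsp}\,\Gamma(x_1),\ldots,\mathrm{colsp}\,\Gamma(x_t))$ of $\mathbb{F}_q$-column spaces (independent of the basis); inclusion of supports is componentwise. A codeword $c\in\mathcal{C}$ is minimal if every $c'\in\mathcal{C}$ whose support is contained in the support of $c$ satisfies $c'=\lambda c$ for some $\lambda\in\mathbb{F}_{q^m}$. $\mathcal{C}$ is minimal if all its codewords are minimal. *)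

(* Defs.v *)
From HB Require Import structures.
From mathcomp Require Import all_boot all_order all_algebra all_field.

Set Implicit Arguments.
Unset Strict Implicit.
Unset Printing Implicit Defensive.

Import GRing.Theory.
Local Open Scope ring_scope.

(* [L : fieldExtType F] with [F] a finite field plays the role of F_{q^m} over
   F_q.  The space L^n = L^{n_1} (+) ... (+) L^{n_t} is the space of block row
   vectors of width [\sum_i n i]; the i-th block of [x] is [submxrow x i]. *)
Notation sumrank_space L n := 'rV[L]_(\sum_i n i)%N.

Section SumRankCodes.

Variables (F : finFieldType) (L : fieldExtType F).

Section Support.

Variables (m : nat) (B : m.-tuple L).

Definition Gamma (n : nat) (x : 'rV[L]_n) : 'M[F]_(n, m) :=
  \matrix_(j, r) coord B r (x 0 j).

Definition colsp (a b : nat) (A : 'M[F]_(a, b)) : {vspace 'cV[F]_a} :=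
  <<[tuple col r A | r < b]>>%VS.

Definition sumrank_support (t : nat) (n : 'I_t -> nat) (x : sumrank_space L n)
    (i : 'I_t) : {vspace 'cV[F]_(n i)} :=
  colsp (Gamma (submxrow x i)).

Definition support_sub (t : nat) (n : 'I_t -> nat)
    (x y : sumrank_space L n) : Prop :=
  forall i : 'I_t, (sumrank_support x i <= sumrank_support y i)%VS.

Definition minimal_codeword (t : nat) (n : 'I_t -> nat)
    (C : {vspace sumrank_space L n}) (c : sumrank_space L n) : Prop :=
  c \in C /\
  forall c' : sumrank_space L n,
    c' \in C -> support_sub c' c -> exists lambda : L, c' = lambda *: c.

Definition minimal_code (t : nat) (n : 'I_t -> nat)
    (C : {vspace sumrank_space L n}) : Prop :=
  forall c : sumrank_space L n, c \in C -> minimal_codeword C c.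

End Support.

Definition generator_matrix (k t : nat) (n : 'I_t -> nat)
    (C : {vspace sumrank_space L n}) (G : 'M[L]_(k, \sum_i n i)) : Prop :=
  basis_of C [tuple row r G | r < k].

(* The columns live in L^k viewed as a vector space over F; since 'cV[L]_k only
   carries the structure of a vector space over L, they are read as elements of
   {ffun 'I_k -> L}, whose vector space structure over F is that of L. *)
Definition free_columns (k n : nat) (A : 'M[L]_(k, n)) : Prop :=
  free [tuple [ffun r : 'I_k => A r j] | j < n].

(* Any two generator matrices differ by an invertible matrix over L acting on
   the left, so the choice of [G] is immaterial. *)
Definition nondegenerate_code (t : nat) (n : 'I_t -> nat)
    (C : {vspace sumrank_space L n}) : Prop :=
  exists G : 'M[L]_(\dim C, \sum_i n i),
    generator_matrix C G /\ forall i : 'I_t, free_columns (submxrow G i).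

End SumRankCodes.

(* Main.v *)
(* Let G = (G_1 | ... | G_t) be a generator matrix over L, with F the base
   field, and let a_i(u) be the F-dimension of {a in F^{n_i} : u G_i a^T = 0}.
   Minimality of uG says that the vectors G_i a^T with u G_i a^T = 0 have no
   common left annihilator in L^k outside L u, so they span a space of dimension
   at least k - 1, whence a_1(u) + ... + a_t(u) >= k - 1.  Convexity of q^x turns
   this into a lower bound for the number of nonzero a orthogonal to u, and
   counting pairs (u, a) with u and a nonzero in two ways gives the theorem: by
   nondegeneracy G_i a^T is nonzero, so it is orthogonal to exactly
   q^{m(k-1)} - 1 nonzero vectors u. *)
Require Import Defs.
From mathcomp Require Import all_boot all_order all_algebra all_field.
From mathcomp Require Import all_character zify.

Set Implicit Arguments.
Unset Strict Implicit.
Unset Printing Implicit Defensive.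

Local Open Scope nat_scope.

Lemma leq_mul_expn_sub1 q d : 0 < q -> (q - 1) * d <= q ^ d - 1.
Proof.
move=> q0; elim: d => [|d IH]; first by rewrite muln0.
have h : 0 < q ^ d by rewrite expn_gt0 q0.
by rewrite expnS; nia.
Qed.

(** Each term obeys q^a - 1 >= (q - 1) a, with equality for a in {0, 1}; hence the bound is attained
    as soon as [b <= t], which is the case [k <= t] of the theorem. *)
Lemma sum_expn_sub1_ge_linear q t (a : 'I_t -> nat) b :
  0 < q -> b <= \sum_i a i -> (q - 1) * b <= \sum_i (q ^ a i - 1).
Proof.
move=> q0 hb; apply: leq_trans (_ : (q - 1) * \sum_i a i <= _).
  by rewrite leq_mul2l hb orbT.
by rewrite big_distrr; apply: leq_sum => i _; apply: leq_mul_expn_sub1.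
Qed.

(* The line through the points of abscissa [s] and [s + 1] of the convex graph
   of [q ^ _] lies below it at every integer; subtractions are moved across. *)
Lemma expn_tangent q s a : 1 < q ->
  (q ^ s - 1) + q ^ s * (q - 1) * a <= (q ^ a - 1) + q ^ s * (q - 1) * s.
Proof.
move=> q1; have q0 : 0 < q by apply: ltnW.
have pow_gt0 j : 0 < q ^ j by rewrite expn_gt0 q0.
case: (leqP s a) => [/subnKC <-|lt_as].
  (* After division by q^s this is the Bernoulli inequality at a - s. *)
  have := leq_mul_expn_sub1 (a - s) q0; set d := a - s.
  have := pow_gt0 d; have := pow_gt0 s; rewrite expnD -!mulnA !mulnDr.
  set A := q ^ s; set D := q ^ d => A0 D0 hD.
  have : A * ((q - 1) * d) <= A * (D - 1) by rewrite leq_mul2l hD orbT.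
  have : A <= A * D by rewrite leq_pmulr.
  by rewrite mulnBr muln1; lia.
(* Here s - a >= 1, so the term q^s (q - 1) (s - a) alone exceeds q^s - 1. *)
have -> : s = a + (s - a).-1.+1 by lia.
set d := (s - a).-1; set A := q ^ (a + d.+1).
have hA : A <= A * (q - 1) * d.+1 by rewrite -mulnA leq_pmulr // muln_gt0 subn_gt0 q1.
by rewrite mulnDr; have := pow_gt0 a; lia.
Qed.

(** Summing [expn_tangent] with the same [s] for every [a i] leaves the linear term c (\sum_i a i -
    t s), nonnegative by hypothesis. *)
Lemma sum_expn_sub1_ge_const q t (a : 'I_t -> nat) s :
  1 < q -> t * s <= \sum_i a i -> t * (q ^ s - 1) <= \sum_i (q ^ a i - 1).
Proof.
move=> q1 hs; set c := q ^ s * (q - 1).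
have : \sum_(i < t) ((q ^ s - 1) + c * a i)
         <= \sum_(i < t) ((q ^ a i - 1) + c * s).
  by apply: leq_sum => i _; apply: expn_tangent.
rewrite !big_split /= -big_distrr /= !sum_nat_const card_ord.
rewrite [t * (c * s)]mulnCA -(leq_add2r (c * (t * s)) (t * _)).
apply: leq_trans.
by rewrite leq_add2l leq_mul2l hs orbT.
Qed.

Import GRing.Theory.
Local Open Scope ring_scope.

Lemma card_annihilator (K : finFieldType) k (x : 'cV[K]_k) : x != 0 ->
  #|[set u : 'rV[K]_k | (u != 0) && (u *m x == 0)]| = (#|K| ^ (k - 1) - 1)%N.
Proof.
move=> x0; have rx : \rank x = 1%N.
  by apply/eqP; rewrite eqn_leq rank_leq_col lt0n mxrank_eq0.
have := card_rowg (kermx x); rewrite mxrank_ker rx => <-.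
rewrite [#|rowg _|](cardsD1 0) mem_rowg sub0mx addKn.
by apply: eq_card => u; rewrite !inE; congr (_ && _); apply/eqP/sub_kermxP.
Qed.

Lemma annihilator_double_count (K F : finFieldType) k t (n : 'I_t -> nat)
    (f : forall i, 'rV[F]_(n i) -> 'cV[K]_k) b :
  (forall i (a : 'rV[F]_(n i)), f i a = 0 -> a = 0) ->
  (forall u : 'rV[K]_k, u != 0 ->
     (b <= \sum_i #|[set a | ((a != 0) && (u *m f i a == 0))%R]|)%N) ->
  (b * (#|K| ^ k - 1)
     <= (\sum_i #|F| ^ n i - t) * (#|K| ^ (k - 1) - 1))%N.
Proof.
move=> f0 hb.
have cardD0 (E : finFieldType) p : #|[set u : 'rV[E]_p | u != 0]| = (#|E| ^ p - 1)%N.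
  have -> : [set u : 'rV[E]_p | u != 0] = [set~ 0] by apply/setP => u; rewrite !inE.
  by rewrite cardsC1 card_mx mul1n subn1.
have -> : (\sum_i #|F| ^ n i - t = \sum_i (#|F| ^ n i - 1))%N.
  rewrite sumnB; first by rewrite sum1_card card_ord.
  by move=> i _; rewrite expn_gt0 (ltnW (card_finRing_gt1 F)).
have -> : (b * (#|K| ^ k - 1) = \sum_(u : 'rV[K]_k | (u != 0)%R) b)%N.
  by rewrite sum_nat_const mulnC -cardD0 cardsE.
apply: leq_trans (leq_sum _ hb) _.
rewrite exchange_big big_distrl /=; apply: leq_sum => i _.
rewrite -cardD0 -sum1_card big_distrl /=.
(* Cardinals become sums of indicators, so that the sums over [u] and [a] can be exchanged. *)
under eq_bigr => u _ do rewrite -sum1dep_card big_mkcondr /=.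
rewrite exchange_big /= (eq_bigl (fun a => a \in [set a | a != 0])); last first.
  by move=> a; rewrite inE.
apply: leq_sum => a; rewrite inE => a0; rewrite mul1n -big_mkcondr sum1dep_card.
by rewrite card_annihilator //; apply: contraNneq a0 => /f0 ->.
Qed.

Section Gamma.

Variables (F : finFieldType) (L : fieldExtType F).

(** [finvect_type L] is the field [L] equipped with the finite structure that counting vectors over
    it requires. *)
Lemma card_fieldExt m (B : m.-tuple L) :
  basis_of fullv B -> #|finvect_type L| = (#|F| ^ m)%N.
Proof.
move=> /size_basis <-.
by rewrite -(@card_vspacef F _ (Vector.class (finvect_type L : vectType F))) card_vspace.
Qed.

(* Each x determines the F-linear map a |-> x a^T into L, of which Gamma B x is
   the matrix in the basis B. *)
Lemma Gamma_mul_scalars m (B : m.-tuple L) n p (x : 'rV[L]_n) (a : 'M[F]_(p, n)) :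
  Gamma B (x *m (map_mx (GRing.in_alg L) a)^T) = a *m Gamma B x.
Proof.
apply/matrixP => i r; rewrite !mxE raddf_sum /=; apply: eq_bigr => j _.
by rewrite !mxE /= mulr_algr linearZ.
Qed.

Lemma Gamma_eq0 m (B : m.-tuple L) n (x : 'rV[L]_n) :
  basis_of fullv B -> (Gamma B x == 0) = (x == 0).
Proof.
move=> hB; apply/eqP/eqP => [/matrixP x0|->]; last first.
  by apply/matrixP => i j; rewrite !mxE linear0.
apply/rowP => j; rewrite mxE (coord_basis hB (memvf (x 0 j))) big1 // => r _.
by have := x0 j r; rewrite !mxE => ->; rewrite scale0r.
Qed.

Lemma colsp_mulmx a b c (A : 'M[F]_(a, b)) (D : 'M[F]_(b, c)) :
  (colsp (A *m D) <= colsp A)%VS.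
Proof.
apply/span_subvP => _ /tnthP[r ->]; rewrite tnth_mktuple.
have -> : col r (A *m D) = \sum_s D s r *: col s A.
  by apply/colP => i; rewrite !mxE summxE; apply: eq_bigr => s _; rewrite !mxE mulrC.
apply: memv_suml => s _; apply: memvZ; apply: memv_span.
by apply/tnthP; exists s; rewrite tnth_mktuple.
Qed.

(** The rows of 1 - A [pinvmx A] kill A on the left, hence kill A' too, so A' factors through A. *)
Lemma colsp_sub_kermx a b c (A : 'M[F]_(a, b)) (A' : 'M[F]_(a, c)) :
  kermx A *m A' = 0 -> (colsp A' <= colsp A)%VS.
Proof.
move=> kA; suff -> : A' = A *m (pinvmx A *m A') by apply: colsp_mulmx.
apply/eqP; rewrite mulmxA -subr_eq0 -[X in X - _]mul1mx -mulmxBl.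
have /submxP[D ->] : (1%:M - A *m pinvmx A <= kermx A)%MS.
  by apply/sub_kermxP; rewrite mulmxBl mul1mx mulmxKpV ?subrr ?submx_refl.
by rewrite -mulmxA kA mulmx0.
Qed.

Lemma free_columns_mul k n (A : 'M[L]_(k, n)) (a : 'rV[F]_n) :
  free_columns A -> A *m (map_mx (GRing.in_alg L) a)^T = 0 -> a = 0.
Proof.
move=> /freeP fA /colP A0; apply/rowP => j; rewrite mxE.
apply: (fA (a 0)); apply/ffunP => r; have := A0 r; rewrite !mxE => A0r.
rewrite sum_ffunE ffunE -[RHS]A0r.
apply: eq_bigr => s _; rewrite -tnth_nth tnth_mktuple !ffunE !mxE /=.
by rewrite mulr_algr.
Qed.

Lemma generator_matrixP t (n : 'I_t -> nat) k (C : {vspace sumrank_space L n})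
    (G : 'M[L]_(k, \sum_i n i)) :
  generator_matrix C G -> row_free G /\ forall u, u *m G \in C.
Proof.
move=> /andP[/eqP spG /freeP frG]; split=> [|u]; last first.
  rewrite mulmx_sum_row -spG; apply: memv_suml => i _; apply/memvZ/memv_span.
  by apply/tnthP; exists i; rewrite tnth_mktuple.
apply: inj_row_free => v; rewrite mulmx_sum_row => v0; apply/rowP => i.
rewrite mxE; apply: frG; rewrite -[RHS]v0; apply: eq_bigr => j _.
by rewrite -tnth_nth tnth_mktuple.
Qed.

(** If v M = 0 for the matrix [M] below, then the support of v G lies in that of u G, so v is a
    multiple of u by minimality. Thus [M] has rank at least k - 1, and the right-hand side is its
    number of columns. *)
Lemma minimal_sum_kernels m (B : m.-tuple L) t (n : 'I_t -> nat) k
    (C : {vspace sumrank_space L n}) (G : 'M[L]_(k, \sum_i n i)) (u : 'rV[L]_k) :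
  basis_of fullv B -> generator_matrix C G -> minimal_code B C ->
  (k - 1 <= \sum_i \rank (kermx (Gamma B (submxrow (u *m G) i))))%N.
Proof.
move=> hB /generator_matrixP[frG GC] minC.
(* The columns of M span over L the vectors G_i a^T orthogonal to u. *)
pose N i := row_base (kermx (Gamma B (submxrow (u *m G) i))).
pose M := \mxrow_i (submxrow G i *m (map_mx (GRing.in_alg L) (N i))^T).
suff kM : (kermx M <= u)%MS.
  have := mxrankS kM; have := rank_leq_row u; have := rank_leq_col M.
  by rewrite mxrank_ker; lia.
apply/row_subP => r; set v := row r _.
have vM : v *m M = 0 by apply/sub_kermxP/row_sub.
have [_ /(_ (v *m G) (GC v))] := minC _ (GC u).
case=> [i|c]; last first.
  by rewrite scalemxAl => /(row_free_inj frG) ->; apply: scalemx_sub.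
apply: colsp_sub_kermx; set A := Gamma B _.
(* It is enough to test on the rows of [N i], where the vanishing is block [i] of v M = 0. *)
have /submxP[D ->] : (kermx A <= N i)%MS by rewrite eq_row_base.
have vN : submxrow (v *m G) i *m (map_mx (GRing.in_alg L) (N i))^T = 0.
  transitivity (submxrow (v *m M) i); last by rewrite vM submxrow0.
  by rewrite mul_mxrow mxrowK mulmxA mul_submxrow.
rewrite -mulmxA -Gamma_mul_scalars vN.
by rewrite (eqP (_ : Gamma B 0 == 0)) ?mulmx0 // Gamma_eq0.
Qed.

Lemma card_scalar_annihilator m (B : m.-tuple L) n (x : 'rV[L]_n) :
  basis_of fullv B ->
  #|[set a : 'rV[F]_n | (a != 0) && (x *m (map_mx (GRing.in_alg L) a)^T == 0)]|
    = (#|F| ^ \rank (kermx (Gamma B x)) - 1)%N.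
Proof.
move=> hB; rewrite -card_rowg [#|rowg _|](cardsD1 0) mem_rowg sub0mx addKn.
apply: eq_card => a; rewrite !inE; congr (_ && _).
by rewrite -(Gamma_eq0 _ hB) Gamma_mul_scalars; apply/eqP/sub_kermxP.
Qed.

End Gamma.

(** The parameter [b] isolates the convexity estimate, the only point where the two cases of the
    theorem differ. *)
Lemma minimal_code_count (F : finFieldType) (L : fieldExtType F) m
    (B : m.-tuple L) t (n : 'I_t -> nat) (C : {vspace sumrank_space L n}) b :
  basis_of fullv B -> nondegenerate_code C -> minimal_code B C ->
  (forall a : 'I_t -> nat, \dim C - 1 <= \sum_i a i ->
     b <= \sum_i (#|F| ^ a i - 1))%N ->
  (b * (#|F| ^ (\dim C * m) - 1)
     <= (\sum_i #|F| ^ n i - t) * (#|F| ^ (m * (\dim C - 1)) - 1))%N.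
Proof.
move=> hB [G [genG freeG]] minC hb.
rewrite [(_ * m)%N]mulnC !expnM -(card_fieldExt hB).
pose f i a : 'cV[finvect_type L]_(\dim C) :=
  submxrow G i *m (map_mx (GRing.in_alg L) a)^T.
apply: (annihilator_double_count (f := f)) => [i a|u u0].
  exact: (free_columns_mul (freeG i)).
apply: leq_trans (hb _ (minimal_sum_kernels u hB genG minC)) _.
apply: leq_sum => i _; rewrite -(card_scalar_annihilator _ hB).
apply: subset_leq_card; apply/subsetP => a; rewrite !inE => /andP[-> /eqP h] /=.
by apply/eqP; rewrite -[RHS]h -mul_submxrow -mulmxA.
Qed.

Local Open Scope nat_scope.
Theorem theorem2p8 (F : finFieldType) (L : fieldExtType F) (q m t k : nat)
    (hq : #|F| = q)
    (B : m.-tuple L) (hB : basis_of fullv B)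
    (ht : 0 < t) (hk : 0 < k)
    (n : 'I_t -> nat) (hn : forall i : 'I_t, 0 < n i)
    (n_noninc : forall i j : 'I_t, i <= j -> n j <= n i)
    (C : {vspace sumrank_space L n}) (dimC : \dim C = k)
    (ndC : nondegenerate_code C) (minC : minimal_code B C) :
  (k <= t ->
     (q - 1) * (k - 1) * (q ^ (k * m) - 1)
       <= ((\sum_(i < t) q ^ n i) - t) * (q ^ (m * (k - 1)) - 1)) /\
  (t <= k - 1 ->
     t * (q ^ ((k - 1) %/ t) - 1) * (q ^ (k * m) - 1)
       <= ((\sum_(i < t) q ^ n i) - t) * (q ^ (m * (k - 1)) - 1)).
Proof.
have q1 : 1 < q by rewrite -hq card_finRing_gt1.
rewrite -hq -dimC in q1 *; split=> hkt; apply: (minimal_code_count hB ndC minC) => a.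
  by apply: sum_expn_sub1_ge_linear; apply: ltnW.
move=> ha; apply: sum_expn_sub1_ge_const => //.
(* The tangent point is the floor of (k - 1) / t, and t times it is at most k - 1. *)
by rewrite mulnC; apply: leq_trans (leq_trunc_div _ _) ha.
Qed.
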